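(* There is a one-to-one correspondence between strict 2-term sh Leibniz algebras with strict homotopy derivations and crossed modules of LeibDer pairs.
   Context: All vector spaces and linear maps are over a field $\mathbb{K}$ of characteristic zero. A (right) Leibniz algebra is a vector space $\mathfrak{g}$ with a bilinear bracket satisfying $[[x,y],z]=[[x,z],y]+[x,[y,z]]$. A LeibDer pair $(\mathfrak{g},\phi_\mathfrak{g})$ is a Leibniz algebra with a derivation $\phi_\mathfrak{g}$; a morphism of LeibDer pairs is a Leibniz algebra morphism commuting with the derivations. A 2-term sh Leibniz algebra $(A_1\xrightarrow{d}A_0,l_2,l_3)$ is a chain complex $A_1\xrightarrow{d}A_0$ with bilinear maps $l_2:A_i\times A_j\to A_{i+j}$ ($0\le i,j,i+j\le1$) and a trilinear map $l_3:A_0\times A_0\times A_0\to A_1$ satisfying a list of identities; it is strict if $l_3=0$, in which case the identities are, for $x,y,z\in A_0$, $m,n\in A_1$: - $dl_2(x,m)=l_2(x,dm)$, $dl_2(m,x)=l_2(dm,x)$, $l_2(dm,n)=l_2(m,dn)$; - $l_2(l_2(x,y),z)-l_2(l_2(x,z),y)-l_2(x,l_2(y,z))=0$; - $l_2(l_2(x,y),m)-l_2(l_2(x,m),y)-l_2(x,l_2(y,m))=0$; - $l_2(l_2(x,m),y)-l_2(l_2(x,y),m)-l_2(x,l_2(m,y))=0$; - $l_2(l_2(m,x),y)-l_2(l_2(m,y),x)-l_2(m,l_2(x,y))=0$. A homotopy derivation on it is a triple $(\theta_0,\theta_1,\theta_2)$ with $\theta_0:A_0\to A_0$, $\theta_1:A_1\to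 A_1$ linear, $d\circ\theta_1=\theta_0\circ d$, and $\theta_2:A_0\times A_0\to A_1$ bilinear satisfying compatibility conditions; it is strict if $\theta_2=0$, in which case (for $l_3=0$) the conditions are - $\theta_0(l_2(x,y))=l_2(\theta_0(x),y)+l_2(x,\theta_0(y))$; - $\theta_1(l_2(x,m))=l_2(\theta_0(x),m)+l_2(x,\theta_1(m))$; - $\theta_1(l_2(m,x))=l_2(\theta_1(m),x)+l_2(m,\theta_0(x))$. A crossed module of LeibDer pairs is a quadruple $((\mathfrak{g},\phi_\mathfrak{g}),(\mathfrak{h},\phi_\mathfrak{h}),dt,\phi)$ where $(\mathfrak{g},\phi_\mathfrak{g}),(\mathfrak{h},\phi_\mathfrak{h})$ are LeibDer pairs, $dt:\mathfrak{g}\to\mathfrak{h}$ is a morphism of LeibDer pairs, and bilinear maps $\phi:\mathfrak{h}\times\mathfrak{g}\to\mathfrak{g}$, $\phi:\mathfrak{g}\times\mathfrak{h}\to\mathfrak{g}$ define a representation of the LeibDer pair $(\mathfrak{h},\phi_\mathfrak{h})$ on $(\mathfrak{g},\phi_\mathfrak{g})$, such that for $m,n\in\mathfrak{g}$, $x\in\mathfrak{h}$: (a) $dt(\phi(x,m))=[x,dt(m)]$, $dt(\phi(m,x))=[dt(m),x]$; (b) $\phi(dt(m),n)=[m,n]$, $\phi(m,dt(n))=[m,n]$; (c) $\phi([m,n],x)=[\phi(m,x),n]+[m,\phi(n,x)]$, $[\phi(x,m),n]=[\phi(x,n),m]+\phi(x,[m,n])$, $[\phi(m,x),n]=\phi([m,n],x)+[m,\phi(x,n)]$;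 (d) $\phi_\mathfrak{g}(\phi(x,m))=\phi(\phi_\mathfrak{h}(x),m)+\phi(x,\phi_\mathfrak{g}(m))$, $\phi_\mathfrak{g}(\phi(m,x))=\phi(\phi_\mathfrak{g}(m),x)+\phi(m,\phi_\mathfrak{h}(x))$. Here a representation of a Leibniz algebra $\mathfrak{h}$ on a vector space $M$ (left and right actions both written $[\,,]$) means $[[m,x],y]=[[m,y],x]+[m,[x,y]]$, $[[x,m],y]=[[x,y],m]+[x,[m,y]]$, $[[x,y],m]=[[x,m],y]+[x,[y,m]]$ for $x,y\in\mathfrak{h}$, $m\in M$; a representation of the LeibDer pair $(\mathfrak{h},\phi_\mathfrak{h})$ on $(M,\phi_M)$ additionally requires $\phi_M[x,m]=[\phi_\mathfrak{h}(x),m]+[x,\phi_M(m)]$, $\phi_M[m,x]=[\phi_M(m),x]+[m,\phi_\mathfrak{h}(x)]$. *)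

(* Defs.v *)
From HB Require Import structures.
From mathcomp Require Import all_boot all_algebra.

Set Implicit Arguments.
Unset Strict Implicit.
Unset Printing Implicit Defensive.

Import GRing.Theory.
Local Open Scope ring_scope.

(* Structures are put on given carriers: [leibder_pair V] is the type of
   LeibDer pair structures on the vector space V, and likewise below. *)

Section LeibDerPairs.

Variable K : fieldType.

(* Right Leibniz algebras: every map [_, z] is a derivation. *)
Record leibniz_algebra (V : lmodType K) := LeibnizAlgebra {
  lbracket :> {bilinear V -> V -> V};
  lbracket_leibniz : forall x y z,
    lbracket (lbracket x y) z
    = lbracket (lbracket x z) y + lbracket x (lbracket y z)
}.

Definition is_derivation (V : lmodType K) (L : leibniz_algebra V)
    (f : {linear V -> V}) : Prop :=
  forall x y, f (L x y) = L (f x) y + L x (f y).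

Record leibder_pair (V : lmodType K) := LeibDerPair {
  pair_leibniz :> leibniz_algebra V;
  pair_der : {linear V -> V};
  pair_derP : is_derivation pair_leibniz pair_der
}.

Definition leibniz_morphism (V W : lmodType K) (L : leibniz_algebra V)
    (M : leibniz_algebra W) (f : {linear V -> W}) : Prop :=
  forall x y, f (L x y) = M (f x) (f y).

Definition leibder_morphism (V W : lmodType K) (L : leibder_pair V)
    (M : leibder_pair W) (f : {linear V -> W}) : Prop :=
  leibniz_morphism L M f /\ (forall x, f (pair_der L x) = pair_der M (f x)).

(* [lact x m] is the left action [x, m] and [ract m x] the right action
   [m, x] of H on M. *)
Record leibniz_representation (H M : lmodType K) (L : leibniz_algebra H)
    (lact : {bilinear H -> M -> M}) (ract : {bilinear M -> H -> M}) : Prop :=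
  LeibnizRepresentation {
  rep_mxy : forall m x y,
    ract (ract m x) y = ract (ract m y) x + ract m (L x y);
  rep_xmy : forall x m y,
    ract (lact x m) y = lact (L x y) m + lact x (ract m y);
  rep_xym : forall x y m,
    lact (L x y) m = ract (lact x m) y + lact x (lact y m)
}.

Record leibder_representation (H M : lmodType K) (L : leibder_pair H)
    (phiM : {linear M -> M})
    (lact : {bilinear H -> M -> M}) (ract : {bilinear M -> H -> M}) : Prop :=
  LeibDerRepresentation {
  rep_leibniz : leibniz_representation L lact ract;
  rep_der_left : forall x m,
    phiM (lact x m) = lact (pair_der L x) m + lact x (phiM m);
  rep_der_right : forall m x,
    phiM (ract m x) = ract (phiM m) x + ract m (pair_der L x)
}.

(* [cm_l] and [cm_r] are the two maps phi : H x G -> G and phi : G x H -> G.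
   [cm_der_l] and [cm_der_r] already follow from [cm_representation]; they are
   listed because the usual definition lists them. *)
Record crossed_module (G H : lmodType K) := CrossedModule {
  cm_g : leibder_pair G;
  cm_h : leibder_pair H;
  cm_dt : {linear G -> H};
  cm_l : {bilinear H -> G -> G};
  cm_r : {bilinear G -> H -> G};
  cm_dt_morphism : leibder_morphism cm_g cm_h cm_dt;
  cm_representation : leibder_representation cm_h (pair_der cm_g) cm_l cm_r;
  cm_dt_l : forall x m, cm_dt (cm_l x m) = cm_h x (cm_dt m);
  cm_dt_r : forall m x, cm_dt (cm_r m x) = cm_h (cm_dt m) x;
  cm_peiffer_l : forall m n, cm_l (cm_dt m) n = cm_g m n;
  cm_peiffer_r : forall m n, cm_r m (cm_dt n) = cm_g m n;
  cm_mnx : forall m n x,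
    cm_r (cm_g m n) x = cm_g (cm_r m x) n + cm_g m (cm_r n x);
  cm_xmn : forall x m n,
    cm_g (cm_l x m) n = cm_g (cm_l x n) m + cm_l x (cm_g m n);
  cm_mxn : forall m x n,
    cm_g (cm_r m x) n = cm_r (cm_g m n) x + cm_g m (cm_l x n);
  cm_der_l : forall x m,
    pair_der cm_g (cm_l x m)
    = cm_l (pair_der cm_h x) m + cm_l x (pair_der cm_g m);
  cm_der_r : forall m x,
    pair_der cm_g (cm_r m x)
    = cm_r (pair_der cm_g m) x + cm_r m (pair_der cm_h x)
}.

(* Strict 2-term sh Leibniz algebra A1 --d--> A0: l3 = 0, and [l2_ij] is the
   component A_i x A_j -> A_(i+j) of l2. *)
Record strict_sh_leibniz (A1 A0 : lmodType K) := StrictShLeibniz {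
  sh_d : {linear A1 -> A0};
  l2_00 : {bilinear A0 -> A0 -> A0};
  l2_01 : {bilinear A0 -> A1 -> A1};
  l2_10 : {bilinear A1 -> A0 -> A1};
  sh_d_l : forall x m, sh_d (l2_01 x m) = l2_00 x (sh_d m);
  sh_d_r : forall m x, sh_d (l2_10 m x) = l2_00 (sh_d m) x;
  sh_peiffer : forall m n, l2_01 (sh_d m) n = l2_10 m (sh_d n);
  sh_xyz : forall x y z,
    l2_00 (l2_00 x y) z - l2_00 (l2_00 x z) y - l2_00 x (l2_00 y z) = 0;
  sh_xym : forall x y m,
    l2_01 (l2_00 x y) m - l2_10 (l2_01 x m) y - l2_01 x (l2_01 y m) = 0;
  sh_xmy : forall x m y,
    l2_10 (l2_01 x m) y - l2_01 (l2_00 x y) m - l2_01 x (l2_10 m y) = 0;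
  sh_mxy : forall m x y,
    l2_10 (l2_10 m x) y - l2_10 (l2_10 m y) x - l2_10 m (l2_00 x y) = 0
}.

(* Strict means theta2 = 0. *)
Record strict_homotopy_derivation (A1 A0 : lmodType K)
    (A : strict_sh_leibniz A1 A0) := StrictHomotopyDerivation {
  theta0 : {linear A0 -> A0};
  theta1 : {linear A1 -> A1};
  theta_d : forall m, sh_d A (theta1 m) = theta0 (sh_d A m);
  theta_xy : forall x y,
    theta0 (l2_00 A x y) = l2_00 A (theta0 x) y + l2_00 A x (theta0 y);
  theta_xm : forall x m,
    theta1 (l2_01 A x m) = l2_01 A (theta0 x) m + l2_01 A x (theta1 m);
  theta_mx : forall m x,
    theta1 (l2_10 A m x) = l2_10 A (theta1 m) x + l2_10 A m (theta0 x)
}.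

Record strict_sh_leibder (A1 A0 : lmodType K) := StrictShLeibDer {
  shd_leibniz :> strict_sh_leibniz A1 A0;
  shd_der : strict_homotopy_derivation shd_leibniz
}.

(* The dictionary with g = A1 and h = A0. *)
Record corresponds (A1 A0 : lmodType K)
    (A : strict_sh_leibder A1 A0) (X : crossed_module A1 A0) : Prop :=
  Corresponds {
  corr_dt : cm_dt X =1 sh_d A;
  corr_bracket_h : forall x y, cm_h X x y = l2_00 A x y;
  corr_bracket_gl : forall m n, cm_g X m n = l2_01 A (sh_d A m) n;
  corr_bracket_gr : forall m n, cm_g X m n = l2_10 A m (sh_d A n);
  corr_l : forall x m, cm_l X x m = l2_01 A x m;
  corr_r : forall m x, cm_r X m x = l2_10 A m x;
  corr_der_h : pair_der (cm_h X) =1 theta0 (shd_der A);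
  corr_der_g : pair_der (cm_g X) =1 theta1 (shd_der A)
}.

End LeibDerPairs.

(* Main.v *)
Require Import Defs.
From HB Require Import structures.
From mathcomp Require Import all_boot all_algebra.
From Stdlib Require Import FunctionalExtensionality ProofIrrelevance.

Set Implicit Arguments.
Unset Strict Implicit.
Unset Printing Implicit Defensive.

Import GRing.Theory.
Local Open Scope ring_scope.

(** The two structures carry the same data with [g = A1], [h = A0], [dt = d],
    [phi = l2], except that a crossed module has one extra operation, the
    bracket of [g].  The Peiffer identities [phi(dt m, n) = [m, n] =
    phi(m, dt n)] say that this bracket is forced to be
    [l2 (d m) n = l2 m (d n)], and the condition [l2 (d m) n = l2 m (d n)] on
    the strict sh side is exactly what makes the two expressions agree.

    With the bracket of [g] eliminated in this way, the axioms match.  The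
    Leibniz identity of [h] and the axioms of the representation of [h] on [g]
    are the quadratic identities of [l2] with the terms rearranged.  The
    remaining axioms of a crossed module come from these by specialisation.
    That [dt] preserves brackets is the equivariance of [d] at an element
    [d m] of [h]; that [phi_g] is a derivation of [g] is its compatibility with
    the action of [h], again at [d m], because [d] commutes with the
    derivations; the Leibniz identity of [g] and the
    compatibilities between its bracket and the action of [h] are
    representation axioms in which one element of [h] has the form [d n], and
    equivariance of [d] rewrites [[x, d n]] as [d (l2 x n)].

    Thus each structure yields a corresponding one of the other kind
    ([crossed_module_of_sh_corresponds], [sh_of_crossed_module_corresponds]).
    Since the relation [corresponds] prescribes all the operations of either
    side in terms of the other, it determines each side uniquely
    ([corresponds_unique_crossed_module], [corresponds_unique_sh]), once
    structures with the same operations are identified by functional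
    extensionality and proof irrelevance.  A relation that is total and
    single-valued in both directions is a bijection. *)

(** * Structures are determined by their operations *)

Section Extensionality.

Variable K : fieldType.

(** Linear and bilinear maps are bundled with proofs of linearity; functional
    extensionality identifies the functions and proof irrelevance the rest. *)
Lemma linear_ext (U V : lmodType K) (f g : {linear U -> V}) :
  f =1 g -> f = g.
Proof.
case: f g => [f [[fA] [fZ]]] [g [[gA] [gZ]]] /= fg.
have {}fg : f = g by apply: functional_extensionality.
subst g.
by rewrite (proof_irrelevance _ gA fA) (proof_irrelevance _ gZ fZ).
Qed.

Lemma bilinear_ext (U V W : lmodType K) (f g : {bilinear U -> V -> W}) :
  (forall x y, f x y = g x y) -> f = g.
Proof.
case: f g => [f [[f1 f2 f3 f4]]] [g [[g1 g2 g3 g4]]] /= fg.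
have {}fg : f = g.
  by apply: functional_extensionality => x; apply: functional_extensionality.
subst g.
by rewrite (proof_irrelevance _ g1 f1) (proof_irrelevance _ g2 f2)
           (proof_irrelevance _ g3 f3) (proof_irrelevance _ g4 f4).
Qed.

Lemma leibniz_algebra_ext (V : lmodType K) (L M : leibniz_algebra V) :
  (forall x y, L x y = M x y) -> L = M.
Proof.
case: L M => [b bP] [c cP] /= /bilinear_ext bc; subst c.
by rewrite (proof_irrelevance _ cP bP).
Qed.

Lemma leibder_pair_ext (V : lmodType K) (L M : leibder_pair V) :
  (forall x y, L x y = M x y) -> pair_der L =1 pair_der M -> L = M.
Proof.
case: L M => [L f fP] [M g gP] /= /leibniz_algebra_ext LM /linear_ext fg.
by subst M g; rewrite (proof_irrelevance _ gP fP).
Qed.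

Lemma crossed_module_ext (G H : lmodType K) (X Y : crossed_module G H) :
    cm_g X = cm_g Y -> cm_h X = cm_h Y -> cm_dt X = cm_dt Y ->
    cm_l X = cm_l Y -> cm_r X = cm_r Y ->
  X = Y.
Proof.
case: X Y => [g h dt l r ? ? ? ? ? ? ? ? ? ? ?].
case=> [g' h' dt' l' r' ? ? ? ? ? ? ? ? ? ? ?] /= *.
by subst g' h' dt' l' r'; f_equal; apply: proof_irrelevance.
Qed.

Lemma strict_sh_leibniz_ext (A1 A0 : lmodType K)
    (A B : strict_sh_leibniz A1 A0) :
    sh_d A = sh_d B -> l2_00 A = l2_00 B -> l2_01 A = l2_01 B ->
    l2_10 A = l2_10 B ->
  A = B.
Proof.
case: A B => [d b l r ? ? ? ? ? ? ?] [d' b' l' r' ? ? ? ? ? ? ?] /= *.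
by subst d' b' l' r'; f_equal; apply: proof_irrelevance.
Qed.

Lemma strict_homotopy_derivation_ext (A1 A0 : lmodType K)
    (A : strict_sh_leibniz A1 A0) (D E : strict_homotopy_derivation A) :
  theta0 D = theta0 E -> theta1 D = theta1 E -> D = E.
Proof.
case: D E => [t0 t1 ? ? ? ?] [t0' t1' ? ? ? ?] /= *.
by subst t0' t1'; f_equal; apply: proof_irrelevance.
Qed.

Lemma strict_sh_leibder_ext (A1 A0 : lmodType K)
    (A B : strict_sh_leibder A1 A0) :
    shd_leibniz A = shd_leibniz B ->
    theta0 (shd_der A) = theta0 (shd_der B) ->
    theta1 (shd_der A) = theta1 (shd_der B) ->
  A = B.
Proof.
case: A B => [A D] [B E] /= AB; subst B => t0 t1.
by rewrite (strict_homotopy_derivation_ext t0 t1).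
Qed.

End Extensionality.

(** * From strict 2-term sh Leibniz algebras to crossed modules *)

Section CrossedModuleOfSh.

Variables (K : fieldType) (A1 A0 : lmodType K) (A : strict_sh_leibder A1 A0).

Let d := sh_d A.
Let t := shd_der A.

(** Of the two expressions [l2 (d m) n] and [l2 m (d n)] for the bracket, the
    first is the definition and [sh_bracket1E] gives the second; the
    representation axioms are easier to apply to the second. *)
Definition sh_bracket1 (m n : A1) : A1 := l2_01 A (d m) n.

Lemma sh_bracket1_bilinear : bilinear_for *:%R *:%R sh_bracket1.
Proof.
split=> [n a m m' | m a n n']; rewrite /sh_bracket1.
  by rewrite linearP linearPl.
by rewrite linearPr.
Qed.

HB.instance Definition _ :=
  bilinear_isBilinear.Build K A1 A1 A1 *:%R *:%R sh_bracket1
    sh_bracket1_bilinear.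

Lemma sh_bracket1E m n : sh_bracket1 m n = l2_10 A m (d n).
Proof. exact: sh_peiffer. Qed.

Lemma l2_00_leibniz x y z :
  l2_00 A (l2_00 A x y) z
  = l2_00 A (l2_00 A x z) y + l2_00 A x (l2_00 A y z).
Proof. by apply/eqP; rewrite -subr_eq0 opprD addrA sh_xyz. Qed.

Lemma l2_representation_mxy m x y :
  l2_10 A (l2_10 A m x) y = l2_10 A (l2_10 A m y) x + l2_10 A m (l2_00 A x y).
Proof. by apply/eqP; rewrite -subr_eq0 opprD addrA sh_mxy. Qed.

Lemma l2_representation_xmy x m y :
  l2_10 A (l2_01 A x m) y = l2_01 A (l2_00 A x y) m + l2_01 A x (l2_10 A m y).
Proof. by apply/eqP; rewrite -subr_eq0 opprD addrA sh_xmy. Qed.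

Lemma l2_representation_xym x y m :
  l2_01 A (l2_00 A x y) m = l2_10 A (l2_01 A x m) y + l2_01 A x (l2_01 A y m).
Proof. by apply/eqP; rewrite -subr_eq0 opprD addrA sh_xym. Qed.

Lemma sh_bracket1_mnx m n x :
  l2_10 A (sh_bracket1 m n) x
  = sh_bracket1 (l2_10 A m x) n + sh_bracket1 m (l2_10 A n x).
Proof. by rewrite !sh_bracket1E l2_representation_mxy sh_d_r. Qed.

(** Here both expressions for the bracket are needed: the axiom for
    [l2 (l2 x m) (d n)] produces [l2 (l2 x (d n)) m], and
    [l2 x (d n) = d (l2 x n)] turns this into the bracket of [l2 x n] with
    [m]. *)
Lemma sh_bracket1_xmn x m n :
  sh_bracket1 (l2_01 A x m) n
  = sh_bracket1 (l2_01 A x n) m + l2_01 A x (sh_bracket1 m n).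
Proof.
by rewrite [LHS]sh_bracket1E l2_representation_xmy -sh_bracket1E -sh_d_l.
Qed.

Lemma sh_bracket1_mxn m x n :
  sh_bracket1 (l2_10 A m x) n
  = l2_10 A (sh_bracket1 m n) x + sh_bracket1 m (l2_01 A x n).
Proof. by rewrite !sh_bracket1E l2_representation_mxy sh_d_l. Qed.

(** An element [p] of [A1] acts on [A1] through [d p] in [A0], and elements of
    [A0] act on the right by derivations of the bracket. *)
Lemma sh_bracket1_leibniz m n p :
  sh_bracket1 (sh_bracket1 m n) p
  = sh_bracket1 (sh_bracket1 m p) n + sh_bracket1 m (sh_bracket1 n p).
Proof.
rewrite [LHS]sh_bracket1E sh_bracket1_mnx.
by rewrite -!sh_bracket1E.
Qed.

Lemma sh_bracket1_der m n :
  theta1 t (sh_bracket1 m n)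
  = sh_bracket1 (theta1 t m) n + sh_bracket1 m (theta1 t n).
Proof. by rewrite /sh_bracket1 theta_xm /d theta_d. Qed.

Lemma sh_d_bracket1 m n : d (sh_bracket1 m n) = l2_00 A (d m) (d n).
Proof. exact: sh_d_l. Qed.

Definition leibder_pair1 : leibder_pair A1 :=
  @LeibDerPair K A1
    (@LeibnizAlgebra K A1 sh_bracket1 sh_bracket1_leibniz)
    (theta1 t) sh_bracket1_der.

Definition leibder_pair0 : leibder_pair A0 :=
  @LeibDerPair K A0
    (@LeibnizAlgebra K A0 (l2_00 A) l2_00_leibniz)
    (theta0 t) (theta_xy t).

Lemma l2_leibder_representation :
  leibder_representation leibder_pair0 (theta1 t) (l2_01 A) (l2_10 A).
Proof.
split; [split | exact: theta_xm | exact: theta_mx].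
- exact: l2_representation_mxy.
- exact: l2_representation_xmy.
- exact: l2_representation_xym.
Qed.

Definition crossed_module_of_sh : crossed_module A1 A0 :=
  @CrossedModule K A1 A0 leibder_pair1 leibder_pair0 d (l2_01 A) (l2_10 A)
    (conj sh_d_bracket1 (theta_d t)) l2_leibder_representation
    (@sh_d_l _ _ _ A) (@sh_d_r _ _ _ A)
    (fun m n => erefl) (fun m n => esym (sh_bracket1E m n))
    sh_bracket1_mnx sh_bracket1_xmn sh_bracket1_mxn
    (theta_xm t) (theta_mx t).

Lemma crossed_module_of_sh_corresponds : corresponds A crossed_module_of_sh.
Proof. by split=> // m n; exact: sh_bracket1E. Qed.

End CrossedModuleOfSh.

(** * From crossed modules to strict 2-term sh Leibniz algebras *)

Section ShOfCrossedModule.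

Variables (K : fieldType) (G H : lmodType K) (X : crossed_module G H).

Let repX := rep_leibniz (cm_representation X).

Lemma cm_peiffer m n : cm_l X (cm_dt X m) n = cm_r X m (cm_dt X n).
Proof. by rewrite cm_peiffer_l cm_peiffer_r. Qed.

Lemma cm_xyz x y z :
  cm_h X (cm_h X x y) z - cm_h X (cm_h X x z) y - cm_h X x (cm_h X y z) = 0.
Proof. by rewrite -addrA -opprD -lbracket_leibniz subrr. Qed.

Lemma cm_xym x y m :
  cm_l X (cm_h X x y) m - cm_r X (cm_l X x m) y - cm_l X x (cm_l X y m) = 0.
Proof. by rewrite -addrA -opprD -(rep_xym repX) subrr. Qed.

Lemma cm_xmy x m y :
  cm_r X (cm_l X x m) y - cm_l X (cm_h X x y) m - cm_l X x (cm_r X m y) = 0.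
Proof. by rewrite -addrA -opprD -(rep_xmy repX) subrr. Qed.

Lemma cm_mxy m x y :
  cm_r X (cm_r X m x) y - cm_r X (cm_r X m y) x - cm_r X m (cm_h X x y) = 0.
Proof. by rewrite -addrA -opprD -(rep_mxy repX) subrr. Qed.

Definition strict_sh_of_crossed_module : strict_sh_leibniz G H :=
  @StrictShLeibniz K G H (cm_dt X) (cm_h X) (cm_l X) (cm_r X)
    (cm_dt_l X) (cm_dt_r X) cm_peiffer cm_xyz cm_xym cm_xmy cm_mxy.

Definition sh_of_crossed_module : strict_sh_leibder G H :=
  @StrictShLeibDer K G H strict_sh_of_crossed_module
    (@StrictHomotopyDerivation K G H strict_sh_of_crossed_module
       (pair_der (cm_h X)) (pair_der (cm_g X))
       (proj2 (cm_dt_morphism X)) (@pair_derP _ _ (cm_h X))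
       (cm_der_l X) (cm_der_r X)).

Lemma sh_of_crossed_module_corresponds : corresponds sh_of_crossed_module X.
Proof.
by split=> // m n /=; rewrite ?cm_peiffer_l ?cm_peiffer_r.
Qed.

End ShOfCrossedModule.

(** * The correspondence is one-to-one *)

Section Uniqueness.

Variables (K : fieldType) (A1 A0 : lmodType K).

(** The bracket of [g], which is not among the operations of [A], is
    recovered from the Peiffer identity contained in [corresponds]. *)
Lemma corresponds_unique_crossed_module (A : strict_sh_leibder A1 A0)
    (X Y : crossed_module A1 A0) :
  corresponds A X -> corresponds A Y -> X = Y.
Proof.
case=> [dX hX gX _ lX rX dhX dgX] [dY hY gY _ lY rY dhY dgY].
apply: crossed_module_ext.
- by apply: leibder_pair_ext => [m n | m]; rewrite ?gX ?gY ?dgX ?dgY.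
- by apply: leibder_pair_ext => [x y | x]; rewrite ?hX ?hY ?dhX ?dhY.
- by apply: linear_ext => m; rewrite dX dY.
- by apply: bilinear_ext => x m; rewrite lX lY.
- by apply: bilinear_ext => m x; rewrite rX rY.
Qed.

Lemma corresponds_unique_sh (A B : strict_sh_leibder A1 A0)
    (X : crossed_module A1 A0) :
  corresponds A X -> corresponds B X -> A = B.
Proof.
case=> [dA hA _ _ lA rA dhA dgA] [dB hB _ _ lB rB dhB dgB].
apply: strict_sh_leibder_ext.
- apply: strict_sh_leibniz_ext.
  + by apply: linear_ext => m; rewrite -dA dB.
  + by apply: bilinear_ext => x y; rewrite -hA hB.
  + by apply: bilinear_ext => x m; rewrite -lA lB.
  + by apply: bilinear_ext => m x; rewrite -rA rB.
- by apply: linear_ext => x; rewrite -dhA dhB.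
- by apply: linear_ext => m; rewrite -dgA dgB.
Qed.

End Uniqueness.

Theorem theorem6p7 (K : fieldType) (charK0 : [pchar K] =i pred0) :
  exists F : forall A1 A0 : lmodType K,
      strict_sh_leibder A1 A0 -> crossed_module A1 A0,
    forall A1 A0 : lmodType K,
      bijective (@F A1 A0) /\
      (forall A : strict_sh_leibder A1 A0, corresponds A (F A1 A0 A)).
Proof.
exists (@crossed_module_of_sh K) => A1 A0.
split; last exact: crossed_module_of_sh_corresponds.
exists (@sh_of_crossed_module K A1 A0) => [A | X].
- apply: corresponds_unique_sh (crossed_module_of_sh_corresponds A).
  exact: sh_of_crossed_module_corresponds.
- apply: corresponds_unique_crossed_module (sh_of_crossed_module_corresponds X).
  exact: crossed_module_of_sh_corresponds.
Qed.
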